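(* Let $t,k,m$ be positive integers with $k\leq m$ and $t\geq 2$. Then $\chi(K^{k,m}_t)=t(m-k+1)$.
   Context: $K^{k,m}_t$ (the fractional multiple of the complete graph $K_t$) is the graph whose vertices are the independent sets of size $k$ in a disjoint union of $m$ copies of the complete graph $K_t$, two of them being adjacent in $K^{k,m}_t$ if they are disjoint. $\chi$ denotes the chromatic number. *)

(* Defs.v *)
From mathcomp Require Import all_boot.

Set Implicit Arguments.
Unset Strict Implicit.
Unset Printing Implicit Defensive.

Record sgraph := SGraph {
  vertex :> finType;
  adj : rel vertex;
  adj_sym : symmetric adj;
  adj_irrefl : irreflexive adj }.

Definition proper_coloring (G : sgraph) (n : nat) (c : {ffun G -> 'I_n}) : bool :=
  [forall x, forall y, adj x y ==> (c x != c y)].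

Definition colorable (G : sgraph) (n : nat) : bool :=
  [exists c : {ffun G -> 'I_n}, proper_coloring c].

Lemma colorable_card (G : sgraph) : exists n, colorable G n.
Proof.
exists #|G|; apply/existsP; exists [ffun x => enum_rank x].
apply/forallP=> x; apply/forallP=> y; apply/implyP=> xy.
rewrite !ffunE (inj_eq enum_rank_inj).
by apply: contraTneq xy => ->; rewrite adj_irrefl.
Qed.

Definition chromatic_number (G : sgraph) : nat := ex_minn (colorable_card G).

Definition independent (G : sgraph) (A : {set G}) : bool :=
  [forall x in A, forall y in A, ~~ adj x y].

Definition complete_adj (t : nat) : rel 'I_t := fun x y => x != y.

Lemma complete_adj_sym t : symmetric (@complete_adj t).
Proof. by move=> x y; rewrite /complete_adj eq_sym. Qed.

Lemma complete_adj_irrefl t : irreflexive (@complete_adj t).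
Proof. by move=> x; rewrite /complete_adj eqxx. Qed.

Definition complete_graph (t : nat) : sgraph :=
  SGraph (@complete_adj_sym t) (@complete_adj_irrefl t).

(* In copies m G, the vertex (i, x) is the vertex x of the i-th copy of G. *)
Definition copies_adj (m : nat) (G : sgraph) : rel ('I_m * G) :=
  fun u v => (u.1 == v.1) && adj u.2 v.2.

Lemma copies_adj_sym m G : symmetric (@copies_adj m G).
Proof. by move=> u v; rewrite /copies_adj eq_sym adj_sym. Qed.

Lemma copies_adj_irrefl m G : irreflexive (@copies_adj m G).
Proof. by move=> u; rewrite /copies_adj adj_irrefl andbF. Qed.

Definition copies (m : nat) (G : sgraph) : sgraph :=
  SGraph (@copies_adj_sym m G) (@copies_adj_irrefl m G).

Definition indep_set (k : nat) (G : sgraph) : finType :=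
  {A : {set G} | independent A && (#|A| == k)}.

(* The condition A != B only matters for k = 0, where it keeps the empty set,
   which is disjoint from itself, from carrying a loop; for 0 < k it follows
   from disjointness. *)
Definition disjointness_adj (k : nat) (G : sgraph) : rel (indep_set k G) :=
  fun A B => (A != B) && [disjoint val A & val B].

Lemma disjointness_adj_sym k G : symmetric (@disjointness_adj k G).
Proof. by move=> A B; rewrite /disjointness_adj eq_sym disjoint_sym. Qed.

Lemma disjointness_adj_irrefl k G : irreflexive (@disjointness_adj k G).
Proof. by move=> A; rewrite /disjointness_adj eqxx. Qed.

(* fractional_multiple k m (complete_graph t) is $K^{k,m}_t$. *)
Definition fractional_multiple (k m : nat) (G : sgraph) : sgraph :=
  SGraph (@disjointness_adj_sym k (copies m G))
         (@disjointness_adj_irrefl k (copies m G)).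

(* Main.v *)
Require Import Defs.
From mathcomp Require Import all_boot all_fingroup zify.

Set Implicit Arguments.
Unset Strict Implicit.
Unset Printing Implicit Defensive.

(** Upper bound: an independent k-set meets k of the m copies, hence one of the
    first m - k + 1 copies.  Colouring it by one of its elements in those copies
    uses t * (m - k + 1) colours, and disjoint sets get distinct colours
    ([fractional_multiple_colorable]).

    Lower bound: this is Tucker's lemma on the octahedral sphere ([tucker]),
    applied in the way Matousek proved the Lovasz-Kneser theorem.  A point of the
    sphere is a nonzero sign vector x on the m * t vertices of the disjoint
    union.  Fix a proper colouring with N colours.  If the positive or the
    negative part of x contains an independent k-set, x is labelled by the
    colour of such a set, signed by the part it lies in; a proper colouring never
    gives one colour to both parts, because they are disjoint.  Otherwise x is
    labelled by the length of a longest alternating subsequence of its signs,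
    read copy after copy, signed by the sign that starts it.  In that case each
    part of x meets at most k - 1 copies.  A copy met by both parts contributes at
    most t to the length and a copy met by one part at most 1, which is at most
    t / 2 since t >= 2; so the length is at most t * (k - 1) ([alt_colorless]).
    Altogether t * (k - 1) + N label values occur, and Tucker's lemma bounds
    m * t by that number ([le_coloring]).

    Tucker's lemma follows from Ky Fan's parity argument.  A maximal chain of
    sign vectors is a permutation (the order in which coordinates become nonzero)
    with a choice of signs.  The number of chains whose labels, sorted by absolute
    value, alternate in sign starting with + is shown to be odd by induction on
    the dimension ([alternating_flagsS]), and such a chain has as many distinct
    absolute values as coordinates ([fan_size]).  Counting modulo 2 is summation
    with respect to [addb]. *)

(** * Sums modulo 2 *)

Local Notation "\xor_ ( i <- r ) F" := (\big[addb/false]_(i <- r) F)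
  (at level 41, F at level 41, i, r at level 50).
Local Notation "\xor_ ( i | P ) F" := (\big[addb/false]_(i | P) F)
  (at level 41, F at level 41, i at level 50).

Lemma xor_involution (T : finType) (P : pred T) (f : T -> T) (F : T -> bool) :
    involutive f -> (forall x, P (f x) = P x) ->
    (forall x, P x -> f x != x) -> (forall x, P x -> F (f x) = F x) ->
  \xor_(x | P x) F x = false.
Proof.
move=> fK Pf fN Ff.
rewrite (bigID (fun x => enum_rank x < enum_rank (f x))) /=.
rewrite [X in _ (+) X](reindex_inj (inv_inj fK)) /=.
rewrite [X in _ (+) X](eq_big (fun x => P x && (enum_rank x < enum_rank (f x)))
  F) ?addbb //.
- move=> x; rewrite Pf fK; case Px: (P x) => //=.
  rewrite -leqNgt leq_eqVlt orbC; case: ltnP => //= le_fx.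
  by apply/negbTE; rewrite eq_sym (inj_eq val_inj) (inj_eq enum_rank_inj) fN.
- by move=> x; rewrite Pf => /andP[/Ff].
Qed.

(** * Alternating families of labels *)

(** A nonzero integer as a sign, true for +, and an absolute value. *)
Definition label := (bool * nat)%type.
Definition opp_label (a : label) : label := (~~ a.1, a.2).
Definition label_le : rel label := relpre snd leq.

(** No label occurs together with its opposite. *)
Definition compatible (s : seq label) :=
  {in s &, forall a b : label, a.2 = b.2 -> a = b}.

Fixpoint alternates (b : bool) (s : seq bool) :=
  if s is x :: s' then (x == b) && alternates (~~ b) s' else true.

(** Only compatible families are considered; there labels of the same absolute
    value are equal, so the order of ties in the sort is irrelevant. *)
Definition fan b (s : seq label) := alternates b (map fst (sort label_le s)).

Lemma label_le_total : total label_le.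
Proof. by move=> a b; exact: leq_total. Qed.

Lemma label_le_trans : transitive label_le.
Proof. by move=> a b c; exact: leq_trans. Qed.

Lemma sub_compatible s1 s2 :
  {subset s1 <= s2} -> compatible s2 -> compatible s1.
Proof. by move=> s12 cs a b /s12 sa /s12 sb; exact: cs. Qed.

Lemma fan_perm b s1 s2 : compatible s1 -> perm_eq s1 s2 -> fan b s1 = fan b s2.
Proof.
move=> cs s12; congr (alternates b (map fst _)); apply/perm_sort_inP => //.
- by move=> x y _ _; exact: label_le_total.
- by move=> x y z _ _ _; exact: label_le_trans.
- move=> x y xs ys /anti_leq; exact: cs.
Qed.

Lemma alternates_negb b s : alternates b (map negb s) = alternates (~~ b) s.
Proof.
elim: s b => //= x s IHs b; rewrite IHs negbK.
by case: x b => [] [].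
Qed.

Lemma fan_opp b s : fan b (map opp_label s) = fan (~~ b) s.
Proof.
by rewrite /fan sort_map -!map_comp -alternates_negb -map_comp.
Qed.

(** The facet-to-ridge step of Ky Fan's argument: deleting an inner term of an
    alternating sequence puts two equal signs side by side, so only the deletion
    of an end counts, while a non-alternating sequence has zero or two deletions
    that alternate. *)
Lemma alternates_rem (I : eqType) (g : I -> bool) r b : uniq r -> r != [::] ->
  \xor_(i <- r) alternates b (map g (rem i r))
    = alternates b (map g r) (+) alternates (~~ b) (map g r).
Proof.
elim: r b => // x r IHr b /= /andP[xr ur] _.
rewrite big_cons /= eqxx.
have -> : \xor_(j <- r)
     alternates b [seq g i | i <- if x == j then r else x :: rem j r]
   = (g x == b) && \xor_(j <- r) alternates (~~ b) (map g (rem j r)).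
  rewrite big_distrr /=; apply: eq_big_seq => j jr.
  by case: eqVneq => // xj; rewrite -xj (negPf xr) in jr.
case: r xr ur IHr => [|y r] xr ur IHr.
  by rewrite big_nil /=; case: (g x) b => [] [].
rewrite IHr // negbK; move: (map g (y :: r)) => q.
by case: (g x) b => [] []; case: (alternates true q); case: (alternates false q).
Qed.

Lemma fan_rem (I : eqType) (f : I -> label) r b :
    uniq r -> r != [::] -> compatible (map f r) ->
  \xor_(i <- r) fan b (map f (rem i r))
    = fan b (map f r) (+) fan (~~ b) (map f r).
Proof.
move=> ur r0 cr; set q := sort (relpre f label_le) r.
have qr : perm_eq q r by rewrite perm_sort.
have uq : uniq q by rewrite (perm_uniq qr).
have sq : sorted label_le (map f q).
  by rewrite sorted_map; apply: sort_sorted => x y; apply: label_le_total.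
have fanq c : fan c (map f r) = alternates c (map (fst \o f) q).
  by rewrite /fan sort_map -map_comp.
rewrite !fanq -(alternates_rem (fst \o f)) //; last first.
  by rewrite -size_eq0 (perm_size qr) size_eq0.
rewrite (perm_big _ qr) /=; apply: eq_big_seq => i ir.
have pq : perm_eq (rem i r) (rem i q).
  rewrite -(perm_cons i) -(permPl (perm_to_rem ir)) perm_sym.
  by rewrite -(permPl (perm_to_rem _)) // (perm_mem qr).
rewrite (@fan_perm _ _ (map f (rem i q))) ?perm_map //; last first.
  by apply: sub_compatible cr => _ /mapP[j /mem_rem jr ->]; apply: map_f.
rewrite /fan sorted_sort -?map_comp //; first exact: label_le_trans.
by apply: subseq_sorted sq; [apply: label_le_trans|apply/map_subseq/rem_subseq].
Qed.

(** Neighbours in the sorted list have opposite signs, so by compatibility their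
    absolute values differ. *)
Lemma fan_size b s M :
  compatible s -> {in s, forall a : label, a.2 < M} -> fan b s -> size s <= M.
Proof.
move=> cs sM; rewrite /fan; set q := sort label_le s => altq.
have qs : perm_eq q s by rewrite perm_sort.
have cq : compatible q by apply: sub_compatible cs => a; rewrite (perm_mem qs).
have sq : sorted label_le q by apply: sort_sorted label_le_total _.
have lq : sorted ltn (map snd q).
  have: sorted (fun a a' : label => a.2 < a'.2) q; last by rewrite sorted_map.
  case: q {qs} cq sq b altq => //= a q.
  elim: q a => //= a' q IHq a cq /andP[aa' sq] b.
  case/and3P => /eqP ab /eqP a'b altq.
  rewrite ltn_neqAle; apply/andP; split; last first.
    apply: (IHq a' _ sq (~~ b)); last by rewrite a'b eqxx.
    by apply: sub_compatible cq => x xq; rewrite inE xq orbT.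
  rewrite [_ <= _]aa' andbT; apply/eqP => /cq.
  rewrite !inE !eqxx orbT => /(_ isT isT) E.
  by move: a'b; rewrite -E ab; case: (b).
rewrite -(perm_size qs) -(size_map snd) -(size_iota 0 M).
apply: uniq_leq_size; first exact: sorted_uniq ltn_trans ltnn _ lq.
by move=> _ /mapP[a aq ->]; rewrite mem_iota sM // -(perm_mem qs).
Qed.

(** * Tucker's lemma on the octahedral sphere *)

(** [Some true] is +, [Some false] is - and [None] is 0. *)
Definition signvec (C : finType) := {ffun C -> option bool}.
Definition opp_vec (C : finType) (x : signvec C) : signvec C :=
  [ffun c => omap negb (x c)].
Definition le_vec (C : finType) (x y : signvec C) :=
  forall c b, x c = Some b -> y c = Some b.
Definition nonzero (C : finType) (x : signvec C) := exists c, x c != None.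

Section Flags.
Variables (n : nat) (lam : signvec 'I_n -> label).
Hypothesis lam_opp : forall x, nonzero x -> lam (opp_vec x) = opp_label (lam x).
Hypothesis lam_le : forall x y, nonzero x -> le_vec x y ->
  (lam x).2 = (lam y).2 -> lam x = lam y.

Implicit Types (p : 'S_n) (s : {ffun 'I_n -> bool}).

(** The j-th vector of the maximal chain given by p and s: p lists the
    coordinates in the order in which they become nonzero, so the coordinates
    p 0, ..., p j carry their sign in s. *)
Definition flag_vec p s (j : nat) : signvec 'I_n :=
  [ffun c => if (p^-1)%g c <= j then Some (s c) else None].

Definition flag_labels p s (r : seq nat) := [seq lam (flag_vec p s j) | j <- r].

Lemma flag_vec_nonzero p s j : j < n -> nonzero (flag_vec p s j).
Proof. by move=> jn; exists (p (Ordinal jn)); rewrite ffunE permK leqnn. Qed.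

Lemma flag_vec_le p s i j : i <= j -> le_vec (flag_vec p s i) (flag_vec p s j).
Proof.
by move=> ij c b; rewrite !ffunE; case: ifP => // ci; rewrite (leq_trans ci).
Qed.

Lemma flag_labels_compatible p s r :
  {in r, forall j, j < n} -> compatible (flag_labels p s r).
Proof.
move=> rn _ _ /mapP[i ir ->] /mapP[j jr ->] eq_ij.
case: (leqP i j) => [ij|/ltnW ji].
  by apply: lam_le => //; [apply/flag_vec_nonzero/rn|apply: flag_vec_le].
by apply/esym/lam_le => //; [apply/flag_vec_nonzero/rn|apply: flag_vec_le].
Qed.

(** The maximal chains in the sphere of the first d coordinates are encoded by
    full-length permutations and signs that are trivial from d on.  With this
    encoding the spheres of all dimensions live in one type, and
    [first_signs d] inside [first_signs d.+1] is the upper hemisphere. *)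
Definition first_perms d := [pred p : 'S_n | perm_on [set i : 'I_n | i < d] p].
Definition first_signs d :=
  [pred s : {ffun 'I_n -> bool} | [forall i : 'I_n, (d <= i) ==> s i]].

Definition alternating_flags d : bool :=
  \xor_(p | first_perms d p) \xor_(s | first_signs d s)
    fan true (flag_labels p s (iota 0 d)).

(** Without its i-th vector, i < d, a chain is contained in exactly one other
    chain, obtained by exchanging the i-th and the next coordinate. *)
Lemma xor_delete_inner d i (s : {ffun 'I_n -> bool}) : i < d -> d < n ->
  \xor_(p | first_perms d.+1 p)
    fan true (flag_labels p s (rem i (iota 0 d.+1))) = false.
Proof.
move=> id dn; have i_n : i < n by lia.
have i1_n : i.+1 < n by lia.
pose t := tperm (Ordinal i_n) (Ordinal i1_n).
have ton : perm_on [set j : 'I_n | j < d.+1] t.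
  apply/subsetP => j; rewrite !inE; apply: contraR => jd.
  rewrite tpermD //; apply: contraNneq jd => <- /=; lia.
apply: (@xor_involution _ _ (fun p => t * p)%g).
- by move=> p; rewrite mulgA tperm2 mul1g.
- move=> p /=; apply/idP/idP => [H|]; last exact: perm_onM.
  by rewrite -[p]mul1g -(tperm2 (Ordinal i_n) (Ordinal i1_n)) -mulgA perm_onM.
- move=> p _; apply/eqP => /(congr1 (fun q => q * p^-1)%g).
  rewrite -mulgA mulgV mulg1 => /permP/(_ (Ordinal i_n)).
  by rewrite tpermL perm1 => /(congr1 val) /=; lia.
move=> p _; congr (fan true _); apply/eq_in_map => j.
rewrite mem_rem_uniq ?iota_uniq // !inE mem_iota => /andP[/eqP ji _].
congr lam; apply/ffunP => c; rewrite !ffunE invMg permM tpermV.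
congr (if _ then _ else _); rewrite /t.
by case: tpermP => [->|->|] //=; lia.
Qed.

(** The same for the last vector: the sign of the coordinate added last is
    reversed.  This stays in the upper hemisphere unless that coordinate is d,
    in which case the ridge lies in the equator. *)
Lemma xor_delete_last d p : d < n -> first_perms d.+1 p -> ~~ first_perms d p ->
  \xor_(s | first_signs d s) fan true (flag_labels p s (iota 0 d)) = false.
Proof.
move=> dn pd1 pd; pose o := Ordinal dn.
have po : p o < d.
  have : p o < d.+1 by have := perm_closed o pd1; rewrite !inE ltnS leqnn.
  rewrite ltnS leq_eqVlt => /orP[/eqP po|//]; case/negP: pd.
  apply/subsetP => j; rewrite !inE; apply: contraR; rewrite -leqNgt leq_eqVlt.
  case/orP => [/eqP dj|dj]; last by rewrite (out_perm pd1) // inE -leqNgt.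
  by rewrite -[j](_ : o = j); [apply/eqP/val_inj|apply: val_inj].
apply: (@xor_involution _ _ (fun s => [ffun i => (i == p o) (+) s i])).
- by move=> s; apply/ffunP => i; rewrite !ffunE addbA addbb.
- move=> s; apply: eq_forallb => i; rewrite ffunE.
  by case: eqP => //= ->; rewrite leqNgt po.
- by move=> s _; apply/eqP => /ffunP/(_ (p o)); rewrite ffunE eqxx; case: (s _).
move=> s _; congr (fan true _); apply/eq_in_map => j; rewrite mem_iota => /= jd.
congr lam; apply/ffunP => c; rewrite !ffunE.
case: eqP => //= ->; rewrite permK /= ifF; last lia.
by rewrite ifF //; lia.
Qed.

(** The lower hemisphere is the antipode of the upper one, so its chains that
    alternate from + correspond to chains of the upper hemisphere that alternate
    from -.  Hence the left-hand side counts the chains of the upper hemisphere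
    that alternate in either way; by [fan_rem] this has the parity of the number
    of pairs of a chain and a ridge of it alternating from +.  Ridges inside the
    hemisphere are counted twice, and those on the equator once. *)
Lemma alternating_flagsS d : d < n ->
  alternating_flags d.+1 = alternating_flags d.
Proof.
move=> dn; pose o := Ordinal dn.
have [r r_iota] : {r | r = iota 0 d.+1} by exists (iota 0 d.+1).
have rn : {in r, forall j, j < n} by move=> j; rewrite r_iota mem_iota; lia.
have neg_half p : first_perms d.+1 p ->
    \xor_(s | first_signs d.+1 s && ~~ s o) fan true (flag_labels p s r)
  = \xor_(s | first_signs d s) fan false (flag_labels p s r).
  move=> pd1.
  (* Antipode, restricted to the coordinates 0, ..., d. *)
  pose h (s : {ffun 'I_n -> bool}) := [ffun i : 'I_n => (i <= d) (+) s i].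
  have hK : involutive h.
    by move=> s; apply/ffunP => i; rewrite !ffunE addbA addbb.
  rewrite (reindex_inj (inv_inj hK)) /=; apply: eq_big => s.
    rewrite ffunE leqnn /= negbK; apply/andP/idP => [[/forallP hs so]|/forallP hs].
      apply/forallP => i; apply/implyP; rewrite leq_eqVlt => /orP[/eqP di|di].
        by rewrite -[i](_ : o = i) //; apply: val_inj.
      by have := hs i; rewrite ffunE di leqNgt di.
    split; last by apply: (implyP (hs o)) => /=.
    apply/forallP => i; apply/implyP => di; rewrite ffunE leqNgt di /=.
    by apply: (implyP (hs i)); lia.
  move=> _; rewrite -(fan_opp true) /flag_labels -map_comp.
  congr (fan true _); apply/eq_in_map => j jr /=.
  rewrite -lam_opp; last exact/flag_vec_nonzero/rn.
  congr lam; apply/ffunP => c; rewrite !ffunE; case: ifP => //= cj.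
  have : (p^-1)%g c \in [set i : 'I_n | i < d.+1].
    by rewrite inE; move: jr; rewrite r_iota mem_iota; lia.
  by rewrite -(perm_closed _ pd1) permKV inE ltnS => ->.
have pos_half p :
    \xor_(s | first_signs d.+1 s && s o) fan true (flag_labels p s r)
  = \xor_(s | first_signs d s) fan true (flag_labels p s r).
  apply: eq_bigl => s /=; apply/andP/forallP => [[/forallP hs so] i|hs].
    apply/implyP; rewrite leq_eqVlt => /orP[/eqP di|di].
      by rewrite -[i](_ : o = i) //; apply: val_inj.
    by apply: (implyP (hs i)).
  split; last by apply: (implyP (hs o)) => /=.
  by apply/forallP => i; apply/implyP => di; apply: (implyP (hs i)); lia.
have -> : alternating_flags d.+1 = \xor_(p | first_perms d.+1 p)
    \xor_(s | first_signs d s) \xor_(i <- r)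
      fan true (flag_labels p s (rem i r)).
  rewrite /alternating_flags -r_iota; apply: eq_bigr => p pd1.
  rewrite (bigID (fun s : {ffun 'I_n -> bool} => s o)) /= pos_half neg_half //.
  rewrite -big_split /=; apply: eq_bigr => s _.
  by rewrite [RHS]fan_rem ?r_iota ?iota_uniq // -r_iota;
     apply: flag_labels_compatible.
have -> : \xor_(p | first_perms d.+1 p) \xor_(s | first_signs d s)
     \xor_(i <- r) fan true (flag_labels p s (rem i r))
   = \xor_(p | first_perms d.+1 p) \xor_(s | first_signs d s)
      fan true (flag_labels p s (iota 0 d)).
  have rE : r = rcons (iota 0 d) d by rewrite r_iota -addn1 iotaD cats1.
  have remd : rem d r = iota 0 d.
    rewrite rem_filter; last by rewrite r_iota iota_uniq.
    rewrite rE filter_rcons /= eqxx /=.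
    by apply/all_filterP/allP => j; rewrite mem_iota /=; lia.
  transitivity (\xor_(p | first_perms d.+1 p) \xor_(s | first_signs d s)
     (\xor_(i <- iota 0 d) fan true (flag_labels p s (rem i r))
       (+) fan true (flag_labels p s (iota 0 d)))).
    apply: eq_bigr => p _; apply: eq_bigr => s _.
    by rewrite {1}rE -cats1 big_cat big_seq1 /= remd.
  under eq_bigr do rewrite big_split /=.
  rewrite big_split /= [X in X (+) _](_ : _ = false) //.
  rewrite exchange_big big1 // => s _.
  rewrite exchange_big big_seq big1 // => i; rewrite mem_iota => id.
  by rewrite r_iota; apply: xor_delete_inner; first lia.
rewrite (bigID (first_perms d)) /= [X in _ (+) X]big1 ?addbF; last first.
  by move=> p /andP[pd1 pd]; apply: xor_delete_last.
apply: eq_bigl => p /=; rewrite andb_idl // => /subsetP pd.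
by apply/subsetP => i /pd; rewrite !inE; lia.
Qed.

Lemma flags_tucker M : (forall x, nonzero x -> (lam x).2 < M) -> n <= M.
Proof.
move=> lamM; have : alternating_flags n.
  suff : forall d, d <= n -> alternating_flags d by apply.
  elim=> [|d IHd] dn; last by rewrite alternating_flagsS // IHd // ltnW.
  rewrite /alternating_flags (big_pred1 1%g) => [|p /=].
    rewrite (big_pred1 [ffun=> true]) // => s /=.
    apply/forallP/eqP => [hs|-> i]; last by rewrite ffunE.
    by apply/ffunP => i; rewrite ffunE; apply: hs.
  apply/idP/eqP => [/subsetP hp|->]; last exact: perm_on1.
  apply/permP => i; rewrite perm1; apply/eqP.
  by apply: contraTT isT => /hp; rewrite inE.
have [[p s] /= fan_ps|no_fan] := pickP (fun q : 'S_n * {ffun 'I_n -> bool} =>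
  fan true (flag_labels q.1 q.2 (iota 0 n))); last first.
  rewrite /alternating_flags big1 // => p _.
  by apply: big1 => s _; have := no_fan (p, s).
have rn : {in iota 0 n, forall j, j < n} by move=> j; rewrite mem_iota.
move=> _; rewrite -(size_iota 0 n) -(size_map (fun j => lam (flag_vec p s j))).
apply: (fan_size _ _ fan_ps); first exact: flag_labels_compatible.
by move=> _ /mapP[j jr ->]; apply/lamM/flag_vec_nonzero/rn.
Qed.

End Flags.

(** Absolute values of labels start at 0, so there are M of them. *)
Theorem tucker (C : finType) (lam : signvec C -> label) M :
    (forall x, nonzero x -> lam (opp_vec x) = opp_label (lam x)) ->
    (forall x y, nonzero x -> le_vec x y ->
       (lam x).2 = (lam y).2 -> lam x = lam y) ->
    (forall x, nonzero x -> (lam x).2 < M) ->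
  #|C| <= M.
Proof.
move=> lam_opp lam_le lamM.
pose h (x : signvec 'I_#|C|) : signvec C := [ffun c => x (enum_rank c)].
have h_nz x : nonzero x -> nonzero (h x).
  by case=> i xi; exists (enum_val i); rewrite ffunE enum_valK.
apply: (@flags_tucker _ (lam \o h)) => [x /h_nz hx|x y /h_nz hx xy|x /h_nz hx] /=.
- by rewrite -lam_opp //; congr lam; apply/ffunP => c; rewrite !ffunE.
- by apply: lam_le => // c b; rewrite !ffunE; apply: xy.
- exact: lamM.
Qed.

(** * Alternating subsequences *)

(** Length of a longest alternating subsequence that starts with b. *)
Fixpoint altlen (b : bool) (s : seq bool) : nat :=
  if s is x :: s' then
    if x == b then (altlen (~~ b) s').+1 else altlen b s'
  else 0.

Definition alt s := maxn (altlen true s) (altlen false s).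

Lemma altlen_negb b s : altlen b (map negb s) = altlen (~~ b) s.
Proof. by elim: s b => //= x s IHs b; rewrite !IHs; case: x b => [] []. Qed.

Lemma alt_negb s : alt (map negb s) = alt s.
Proof. by rewrite /alt !altlen_negb maxnC. Qed.

Lemma altlen_switch b s : altlen b s <= (altlen (~~ b) s).+1.
Proof. by case: s => //= x s; case: x b => [] [] /=; lia. Qed.

Lemma altlen_subseq b s1 s2 : subseq s1 s2 -> altlen b s1 <= altlen b s2.
Proof.
elim: s2 s1 b => [|y s2 IHs] [|x s1] b //= .
case: (eqVneq x y) => [-> s12|xy s12].
  by case: ifP => _; rewrite ?ltnS IHs.
apply: leq_trans (IHs _ b s12) _; case: ifP => // _; exact: altlen_switch.
Qed.

Lemma altlen_neq s : s != [::] -> altlen true s != altlen false s.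
Proof. by case: s => [|[] s] //= _; lia. Qed.

Lemma altlen_le_alt b s : altlen b s <= alt s.
Proof. by case: b; rewrite leq_max leqnn ?orbT. Qed.

Lemma alt_gt0 s : s != [::] -> 0 < alt s.
Proof. by move/altlen_neq; rewrite /alt; lia. Qed.

Lemma alt_cat s1 s2 : alt (s1 ++ s2) <= alt s1 + alt s2.
Proof.
have altlen_cat b : altlen b (s1 ++ s2) <= altlen b s1 + alt s2.
  elim: s1 b => [|x s1 IHs] b /=; first exact: altlen_le_alt.
  by case: ifP => _ //; rewrite addSn ltnS.
by rewrite {1}/alt geq_max !(leq_trans (altlen_cat _)) // leq_add2r altlen_le_alt.
Qed.

(** The lengths started by + and by - differ by one and only grow from r1 to r2,
    so if their maximum stays the same the longer one does not change sides. *)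
Lemma alt_first_sign (r1 r2 : seq bool) : r1 != [::] -> subseq r1 r2 ->
    (alt r1).-1 = (alt r2).-1 ->
  (altlen false r1 < altlen true r1) = (altlen false r2 < altlen true r2).
Proof.
move=> r1_0 r12 eq_alt; have r2_0 : r2 != [::].
  by apply: contraNneq r1_0 => E; move: r12; rewrite E subseq0.
move: (alt_gt0 r1_0) (alt_gt0 r2_0) (altlen_neq r1_0) (altlen_neq r2_0).
move: (altlen_subseq true r12) (altlen_subseq false r12).
move: (altlen_switch true r1) (altlen_switch false r1).
move: (altlen_switch true r2) (altlen_switch false r2).
by move: eq_alt; rewrite /alt /=; lia.
Qed.

Lemma altlen_size b s : altlen b s <= size s.
Proof. by elim: s b => //= x s IHs b; case: ifP => _; rewrite ?ltnS ?leqW. Qed.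

(** The bound of one copy: if both signs occur the length is at most t, and if
    one occurs it is at most 1, whose double is at most t. *)
Lemma alt_block t s : 1 < t -> size s <= t ->
  (alt s).*2 <= t * ((true \in s) + (false \in s)).
Proof.
move=> t1 st; have alt_t : alt s <= t.
  by rewrite geq_max !(leq_trans (altlen_size _ _)).
have alt_const b : ~~ b \notin s -> alt s <= 1.
  have altlen_const c : ~~ b \notin s -> altlen c s <= (c == b).
    elim: s c {st alt_t} => //= x s IHs c; rewrite inE negb_or => /andP[bx bs].
    have -> : x = b by move: bx; case: x b {bs IHs} => [] [].
    case: (eqVneq b c) => [<-|bc].
      by have := IHs (~~ b) bs; case: (b).
    by have := IHs c bs; rewrite eq_sym (negPf bc).
  by move=> bs; rewrite geq_max !(leq_trans (altlen_const _ bs)) ?leq_b1.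
case Et: (true \in s); case Ef: (false \in s) => /=.
- by rewrite -muln2 leq_mul2r alt_t orbT.
- have := alt_const true; rewrite Ef => /(_ isT); lia.
- have := alt_const false; rewrite Et => /(_ isT); lia.
by case: s Et Ef {st alt_t alt_const} => // [[] s]; rewrite !inE.
Qed.

Lemma pmap_le_vec (C : finType) (x y : signvec C) e :
  le_vec x y -> subseq (pmap x e) (pmap y e).
Proof.
move=> xy; elim: e => //= c e IHe; case xc: (x c) => [b|] /=.
  by rewrite (xy _ _ xc) /= eqxx.
by case: (y c) => //= b; apply: subseq_trans IHe (subseq_cons _ _).
Qed.

Lemma pmap_opp_vec (C : finType) (x : signvec C) e :
  pmap (opp_vec x) e = map negb (pmap x e).
Proof. by elim: e => //= c e ->; rewrite ffunE; case: (x c). Qed.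

Lemma mem_pmap_vec (C : finType) (x : signvec C) e b :
  (b \in pmap x e) = has (fun c => x c == Some b) e.
Proof.
by elim: e => //= c e <-; case: (x c) => //= b'; rewrite inE eq_sym.
Qed.

(** * Sign vectors on the copies of the complete graph *)

Section Blocks.
Variables (m t : nat).
Local Notation C := ('I_m * 'I_t)%type.

Definition by_blocks : seq C := [seq (i, j) | i <- enum 'I_m, j <- enum 'I_t].

Definition hits b (x : signvec C) : {set 'I_m} :=
  [set i | [exists j, x (i, j) == Some b]].

Lemma by_blocks_nil (x : signvec C) : nonzero x -> pmap x by_blocks != [::].
Proof.
case=> [[i j]]; case xij: (x (i, j)) => [b|] // _.
suff : b \in pmap x by_blocks by apply: contraTneq => ->.
rewrite mem_pmap_vec; apply/hasP; exists (i, j); last exact/eqP.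
by apply: allpairs_f; rewrite mem_enum.
Qed.

Lemma alt_hits (x : signvec C) : 1 < t ->
  (alt (pmap x by_blocks)).*2 <= t * (#|hits true x| + #|hits false x|).
Proof.
move=> t1.
have card_hits b : #|hits b x| = \sum_(i <- enum 'I_m) (i \in hits b x).
  by rewrite -sum1_card big_mkcond big_enum; apply: eq_bigr => i _; case: ifP.
have -> : #|hits true x| + #|hits false x|
    = \sum_(i <- enum 'I_m) ((i \in hits true x) + (i \in hits false x)).
  by rewrite !card_hits -big_split.
rewrite /by_blocks; elim: (enum 'I_m) => [|i l IHl]; first by rewrite big_nil.
rewrite big_cons allpairs_cons pmap_cat mulnDr.
have := alt_cat (pmap x [seq (i, j) | j <- enum 'I_t])
  (pmap x [seq (i, j) | i <- l, j <- enum 'I_t]).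
rewrite -leq_double doubleD => /leq_trans; apply.
rewrite leq_add // (leq_trans (alt_block t1 _)) //.
  by rewrite size_pmap (leq_trans (count_size _ _)) // size_map size_enum_ord.
have hitsE b : (b \in pmap x [seq (i, j) | j <- enum 'I_t]) = (i \in hits b x).
  rewrite mem_pmap_vec has_map inE; apply/hasP/existsP => [[j _ xij]|[j xij]].
    by exists j.
  by exists j; rewrite ?mem_enum.
by rewrite !hitsE.
Qed.

Lemma transversal k b (x : signvec C) : k <= #|hits b x| ->
  exists A : {set copies m (complete_graph t)},
    [/\ independent A, #|A| = k & {in A, forall u, x u = Some b}].
Proof.
case/card_geqP => s [us <- sH].
pose g i := [pick j | x (i, j) == Some b].
pose A : {set C} := [set u | (u.1 \in s) && (g u.1 == Some u.2)].
have fst_inj : {in A &, injective fst}.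
  move=> [i j] [i' j']; rewrite !inE /=.
  move=> /andP[_ /eqP gi] /andP[_ /eqP gi'] ii'.
  by move: gi'; rewrite -ii' gi => -[->].
exists A; split.
- apply/forallP => u; apply/implyP => uA; apply/forallP => v; apply/implyP => vA.
  apply/negP => /andP[/eqP /(fst_inj _ _ uA vA) ->].
  by rewrite /= /complete_adj eqxx.
- rewrite -(card_in_imset fst_inj) -(card_uniqP us).
  apply: eq_card => i; apply/imsetP/idP => [[u]|si].
    by rewrite inE => /andP[us' _] ->.
  have := sH i si; rewrite inE => /existsP[j xij].
  case gi: (g i) => [j'|].
    by exists (i, j'); rewrite // inE /= si gi /=.
  by move: gi; rewrite /g; case: pickP => // /(_ j); rewrite xij.
- move=> [i j]; rewrite inE /g /= => /andP[_].
  by case: pickP => // j' /eqP xij /eqP[<-].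
Qed.

End Blocks.

(** * Lower bound *)

Section Lower.
Variables (t k m N : nat).
Hypotheses (t1 : 1 < t) (k0 : 0 < k).
Local Notation C := ('I_m * 'I_t)%type.
Local Notation G := (fractional_multiple k m (complete_graph t)).
Variable c : {ffun G -> 'I_N}.
Hypothesis c_proper : proper_coloring c.

Definition colors b (x : signvec C) : {set 'I_N} :=
  [set c A | A : G & [forall u in val A, x u == Some b]].

Lemma colors_disjoint x i :
  i \in colors true x -> i \in colors false x -> False.
Proof.
move=> /imsetP[A xA ->] /imsetP[B yB] cAB.
have AB : [disjoint val A & val B].
  apply/pred0P => u /=; apply/negbTE/andP => -[uA uB].
  move: xA yB; rewrite !inE => /forall_inP/(_ u uA)/eqP xu /forall_inP/(_ u uB).
  by rewrite xu.
have A0 : A != B.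
  apply: contraTneq k0 => E; move: AB; rewrite -E -setI_eq0 setIid => /eqP A0.
  by case/andP: (valP A) => _; rewrite A0 cards0 => /eqP <-.
have /forallP/(_ A)/forallP/(_ B)/implyP := c_proper.
by rewrite /= /disjointness_adj A0 AB cAB eqxx => /(_ isT).
Qed.

Lemma colors_opp b x : colors b (opp_vec x) = colors (~~ b) x.
Proof.
have opp_in (A : G) : [forall u in val A, opp_vec x u == Some b]
    = [forall u in val A, x u == Some (~~ b)].
  apply: eq_forallb => u; rewrite ffunE.
  by case: (x u) b => [[]|] [].
by apply/setP => i; apply/imsetP/imsetP => -[A xA ->]; exists A => //;
   move: xA; rewrite !inE opp_in.
Qed.

Lemma colors_mono b x y : le_vec x y -> {subset colors b x <= colors b y}.
Proof.
move=> xy _ /imsetP[A xA ->]; apply: imset_f; rewrite inE.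
apply/forall_inP => u uA; apply/eqP/xy/eqP.
by move: xA; rewrite inE => /forall_inP/(_ u uA).
Qed.

Lemma hits_lt_k b x : colors b x = set0 -> #|hits b x| < k.
Proof.
move=> no_color; rewrite ltnNge; apply/negP => /transversal[A [indA cardA xA]].
have AP : independent A && (#|A| == k) by rewrite indA cardA eqxx.
have : c (exist _ A AP) \in colors b x.
  by apply/imset_f; rewrite inE; apply/forall_inP => u /xA ->.
by rewrite no_color inE.
Qed.

Let a := t * k.-1.

(** Alternation lengths, which are positive, are shifted to start at 0 and stay
    below a; colours come above them.  The colour is picked from a set that
    the antipode leaves invariant, hence it is the same for x and its opposite. *)
Definition color_label (x : signvec C) : label :=
  if [pick i in colors true x :|: colors false x] is Some i
  then (i \in colors true x, a + i)
  else let r := pmap x (by_blocks m t) in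
       (altlen false r < altlen true r, (alt r).-1).

Lemma alt_colorless x : colors true x :|: colors false x = set0 ->
  alt (pmap x (by_blocks m t)) <= a.
Proof.
move/eqP; rewrite setU_eq0 => /andP[/eqP/hits_lt_k Ht /eqP/hits_lt_k Hf].
rewrite /a -leq_double doubleMr (leq_trans (alt_hits x t1)) // leq_mul2l.
by apply/orP; right; lia.
Qed.

Lemma alt_label_lt x : nonzero x -> colors true x :|: colors false x =i pred0 ->
  (alt (pmap x (by_blocks m t))).-1 < a.
Proof.
move=> /by_blocks_nil/alt_gt0 alt0 nox.
suff /alt_colorless : colors true x :|: colors false x = set0 by lia.
by apply/setP => i; rewrite nox !inE.
Qed.

Lemma le_coloring : m * t <= a + N.
Proof.
have <- : #|{: C}| = m * t by rewrite card_prod !card_ord.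
have nonzero_le (x y : signvec C) : nonzero x -> le_vec x y -> nonzero y.
  move=> [u]; case xu: (x u) => [b|] // _ /(_ u b xu) yu.
  by exists u; rewrite yu.
apply: (@tucker _ color_label) => [x x0|x y x0 xy|x x0]; rewrite /color_label.
- rewrite !colors_opp setUC; case: pickP => [i|_].
    rewrite inE => Hi; congr (_, _) => /=.
    apply/idP/negP => [if_ it|]; first exact: colors_disjoint it if_.
    by case/orP: Hi.
  rewrite pmap_opp_vec alt_negb !altlen_negb /opp_label /=.
  congr (_, _); have := altlen_neq (by_blocks_nil x0).
  by rewrite -leqNgt [in RHS]leq_eqVlt => /negPf ->.
- have y0 := nonzero_le x y x0 xy.
  case: pickP => [i Hi|nox]; case: pickP => [j Hj|noy] /=.
  + move=> /addnI/val_inj ij; subst j; congr (_, _).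
    apply/idP/idP => [|it]; first exact: colors_mono.
    move: Hi; rewrite inE => /orP[] // /(colors_mono xy) if_.
    by case: (colors_disjoint it if_).
  + by move=> E; have := alt_label_lt y0 noy; rewrite -E ltnNge leq_addr.
  + by move=> E; have := alt_label_lt x0 nox; rewrite E ltnNge leq_addr.
  + move=> E; congr (_, _) => //; apply: alt_first_sign => //.
      exact: by_blocks_nil.
    exact: pmap_le_vec.
- case: pickP => [i _|/(alt_label_lt x0) nox] /=; first by rewrite ltn_add2l.
  by rewrite ltn_addr.
Qed.

End Lower.

(** * Upper bound *)

Lemma proper_colorable (G : sgraph) (T : finType) (f : G -> T) :
  (forall x y, adj x y -> f x != f y) -> colorable G #|T|.
Proof.
move=> fP; apply/existsP; exists [ffun x => enum_rank (f x)].
apply/forallP => x; apply/forallP => y; apply/implyP => /fP.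
by rewrite !ffunE (inj_eq enum_rank_inj).
Qed.

Lemma fractional_multiple_colorable t k m : 0 < k -> k <= m ->
  colorable (fractional_multiple k m (complete_graph t)) (t * (m - k + 1)).
Proof.
move=> k0 km; have low_le : (m - k).+1 <= m by lia.
have low_mem (A : indep_set k (copies m (complete_graph t))) :
    exists v : 'I_(m - k).+1 * 'I_t, (widen_ord low_le v.1, v.2) \in val A.
  case/andP: (valP A) => /forall_inP indA /eqP cardA.
  have fst_inj : {in val A &, injective fst}.
    move=> [i j] [i' j'] uA /(forall_inP (indA _ uA)) + /= ii'.
    by rewrite /= /copies_adj /= /complete_adj ii' eqxx negbK => /eqP ->.
  pose low := [set widen_ord low_le i | i : 'I_(m - k).+1].
  have card_low : #|low| = (m - k).+1.
    rewrite card_imset ?card_ord // => i j /(congr1 val) /= ij.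
    exact: val_inj.
  (* k + (m - k + 1) > m, so two such sets of copies intersect. *)
  have /set0Pn[i] : (fst @: val A) :&: low != set0.
    rewrite -card_gt0; have := cardsUI (fst @: val A) low.
    have : #|(fst @: val A) :|: low| <= m.
      by rewrite -[m in _ <= m]card_ord max_card.
    rewrite card_low (card_in_imset fst_inj) cardA.
    move: #|_ :|: _| #|_ :&: _| => u v; lia.
  rewrite inE => /andP[/imsetP[[i' j] uA ->] /imsetP[l _ /= i'l]].
  by exists (l, j); rewrite -i'l.
have -> : t * (m - k + 1) = #|{: 'I_(m - k).+1 * 'I_t}|.
  by rewrite card_prod !card_ord addn1 mulnC.
apply: (@proper_colorable (fractional_multiple k m (complete_graph t)) _
  (fun A => xchoose (low_mem A))) => A B /andP[_].
apply: contraTneq => AB; apply/pred0Pn.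
have := xchooseP (low_mem A); have := xchooseP (low_mem B).
by rewrite -AB => uB uA; eexists; apply/andP; split; [exact: uA|exact: uB].
Qed.

Theorem corollary2 (t k m : nat) (hk : 0 < k) (hm : 0 < m) (hkm : k <= m)
    (ht : 2 <= t) :
  chromatic_number (fractional_multiple k m (complete_graph t))
    = t * (m - k + 1).
Proof.
rewrite /chromatic_number; case: ex_minnP => N /existsP[c cP] min_N.
apply/eqP; rewrite eqn_leq min_N ?fractional_multiple_colorable //=.
have := le_coloring ht hk cP.
have -> : m * t = t * (m - k + 1) + t * k.-1.
  by rewrite -mulnDr mulnC; congr (_ * _); lia.
by rewrite addnC leq_add2l.
Qed.
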